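(* Let $J,R,Q\in\mathbb{C}^{n,n}$ with $J^*=-J$, $R^*=R\ge 0$ and $Q^*=Q>0$, and suppose that the dissipative Hamiltonian system $\dot x=(J-R)Qx$ is asymptotically stable. Then $$\left(r^{S_d}(J,R)\right)^2=\inf_{\omega\in\mathbb{R}}\ \inf_{x\in\mathbb{C}^n\setminus\{0\}}\left\{\left(\frac{x^*QR^2Qx}{x^*QRQx}\right)^2+\frac{x^*(i\omega I_n-JQ)^*(i\omega I_n-JQ)x}{x^*Q^2x}\right\}.$$ Furthermore, if the infimum is attained at $\hat\omega\in\mathbb{R}$ and $\hat x\in\mathbb{C}^n\setminus\{0\}$, then for $$\hat\Delta_J=-i\,\hat H_{(Q\hat x,\; i(i\hat\omega I_n-JQ)\hat x)},\qquad \hat\Delta_R=\frac{-1}{\hat x^*QRQ\hat x}(RQ\hat x)(RQ\hat x)^*$$ (with $\hat\Delta_R:=0$ if $RQ\hat x=0$) one has $$r^{S_d}(J,R)=\sqrt{\|\hat\Delta_J\|^2+\|\hat\Delta_R\|^2}.$$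
   Context: $\mathbb{C}^{n,n}$ is the set of complex $n\times n$ matrices; $\|\cdot\|$ is the spectral norm of a matrix (and the Euclidean norm of a vector); $\Lambda(A)$ is the spectrum of $A$; $A\ge 0$, $A\le 0$, $A>0$ mean that $A$ is Hermitian and positive semidefinite, negative semidefinite, positive definite, respectively. The system $\dot x=(J-R)Qx$ is asymptotically stable if all eigenvalues of $(J-R)Q$ lie in the open left half plane. For $(\Delta_J,\Delta_R)\in(\mathbb{C}^{n,n})^2$ put $|||(\Delta_J,\Delta_R)|||=\sqrt{\|\Delta_J\|^2+\|\Delta_R\|^2}$. The perturbation set is $$S_d(J,R)=\{(\Delta_J,\Delta_R)\in(\mathbb{C}^{n,n})^2:\ \Delta_J^*=-\Delta_J,\ \Delta_R^*=\Delta_R\le 0,\ R+\Delta_R\ge 0\},$$ and the structured stability radius is $$r^{S_d}(J,R)=\inf\{|||(\Delta_J,\Delta_R)|||:\ (\Delta_J,\Delta_R)\in S_d(J,R),\ \Lambda((J+\Delta_J-(R+\Delta_R))Q)\cap i\mathbb{R}\neq\emptyset\}.$$ Convention: a generalized Rayleigh quotient $\frac{x^*H_1x}{x^*H_2x}$ with $H_1,H_2\ge 0$ is defined to be $0$ when both $x^*H_1x=0$ and $x^*H_2x=0$. For $x\in\mathbb{C}^n\setminus\{0\}$ and $y\in\mathbb{C}^n$ with $\mathrm{Im}(x^*y)=0$, define $$\hat H_{(x,y)}=\frac{\|y\|}{\|x\|}\begin{bmatrix}\frac{y}{\|y\|}&\frac{x}{\|x\|}\end{bmatrix}\begin{bmatrix}\frac{y^*x}{\|x\|\|y\|}&1\\1&\frac{x^*y}{\|x\|\|y\|}\end{bmatrix}^{-1}\begin{bmatrix}\frac{y}{\|y\|}&\frac{x}{\|x\|}\end{bmatrix}^*$$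 if $x,y$ are linearly independent, and $\hat H_{(x,y)}=\frac{yx^*}{x^*x}$ otherwise. *)

(* Defs.v *)
From mathcomp Require Import all_boot all_order all_algebra.
From mathcomp Require Import classical_sets reals constructive_ereal ereal.
From mathcomp Require Import complex.

Set Implicit Arguments.
Unset Strict Implicit.
Unset Printing Implicit Defensive.

Import Order.TTheory GRing.Theory Num.Theory.

Local Open Scope classical_set_scope.
Local Open Scope ring_scope.
Local Open Scope sesquilinear_scope.
Local Open Scope complex_scope.

(* [K : realType] plays the role of the real numbers, [K[i]] that of the
   complex numbers, and [A^t*] is the conjugate transpose of [A].  The order on
   [K[i]] is partial: [0 <= z] means that [z] is real and nonnegative. *)

Definition psd (K : realType) (n : nat) (A : 'M[K[i]]_n) : Prop :=
  A^t* = A /\ forall x : 'cV[K[i]]_n, 0 <= (x^t* *m A *m x) 0 0.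

Definition nsd (K : realType) (n : nat) (A : 'M[K[i]]_n) : Prop :=
  A^t* = A /\ forall x : 'cV[K[i]]_n, (x^t* *m A *m x) 0 0 <= 0.

Definition posdef (K : realType) (n : nat) (A : 'M[K[i]]_n) : Prop :=
  A^t* = A /\ forall x : 'cV[K[i]]_n, x != 0 -> 0 < (x^t* *m A *m x) 0 0.

Definition enorm (K : realType) (n : nat) (x : 'cV[K[i]]_n) : K :=
  Num.sqrt (complex.Re ((x^t* *m x) 0 0)).

Definition specnorm (K : realType) (n : nat) (A : 'M[K[i]]_n) : K :=
  sup [set enorm (A *m x) | x in [set x : 'cV[K[i]]_n | enorm x = 1]].

Definition pairnorm (K : realType) (n : nat) (D : 'M[K[i]]_n * 'M[K[i]]_n) : K :=
  Num.sqrt (specnorm D.1 ^+ 2 + specnorm D.2 ^+ 2).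

(* [eigenvalue] refers to left (row) eigenvectors; the spectrum is the same. *)
Definition asymptotically_stable (K : realType) (n : nat)
    (J R Q : 'M[K[i]]_n) : Prop :=
  forall l : K[i], eigenvalue ((J - R) *m Q) l -> complex.Re l < 0.

(* The structure set S_d(J,R) does not depend on J. *)
Definition Sd (K : realType) (n : nat) (R : 'M[K[i]]_n) :
    set ('M[K[i]]_n * 'M[K[i]]_n) :=
  [set D | [/\ D.1^t* = - D.1, nsd D.2 & psd (R + D.2)]].

(* The infimum is taken in the extended reals, where inf of the empty set
   is +oo. *)
Definition stability_radius (K : realType) (n : nat)
    (J R Q : 'M[K[i]]_n) : \bar K :=
  ereal_inf [set (pairnorm D)%:E | D in
    [set D | Sd R D /\
       exists l : K[i], eigenvalue ((J + D.1 - (R + D.2)) *m Q) l /\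
                        complex.Re l = 0]].

(* For Hermitian [H] the number x^* H x is real, so [Re] loses nothing. *)
Definition qform (K : realType) (n : nat) (H : 'M[K[i]]_n) (x : 'cV[K[i]]_n) : K :=
  complex.Re ((x^t* *m H *m x) 0 0).

Definition rayleigh (K : realType) (n : nat) (H1 H2 : 'M[K[i]]_n)
    (x : 'cV[K[i]]_n) : K :=
  if (qform H1 x == 0) && (qform H2 x == 0) then 0 else qform H1 x / qform H2 x.

(* The matrix i w I_n - J Q. *)
Definition shifted (K : realType) (n : nat) (J Q : 'M[K[i]]_n) (w : K) : 'M[K[i]]_n :=
  ('i%C * w%:C)%:M - J *m Q.

Definition objective (K : realType) (n : nat) (J R Q : 'M[K[i]]_n)
    (w : K) (x : 'cV[K[i]]_n) : K :=
  rayleigh (Q *m (R *m R) *m Q) (Q *m R *m Q) x ^+ 2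
  + rayleigh ((shifted J Q w)^t* *m shifted J Q w) (Q *m Q) x.

Definition objective_inf (K : realType) (n : nat) (J R Q : 'M[K[i]]_n) : \bar K :=
  ereal_inf [set ereal_inf [set (objective J R Q w x)%:E |
                              x in [set x : 'cV[K[i]]_n | x != 0]]
            | w in [set: K]].

(* The mapping matrix \hat H_{(x,y)}, meaningful for x != 0 and Im (x^* y) = 0. *)
Definition Hhat (K : realType) (n : nat) (x y : 'cV[K[i]]_n) : 'M[K[i]]_n :=
  if free [:: x; y] then
    let U : 'M[K[i]]_(n, 1 + 1) :=
      row_mx ((enorm y)^-1%:C *: y) ((enorm x)^-1%:C *: x) in
    let c := (enorm x * enorm y)^-1%:C in
    let M : 'M[K[i]]_(1 + 1) :=
      block_mx (c *: (y^t* *m x)) 1%:M 1%:M (c *: (x^t* *m y)) in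
    (enorm y / enorm x)%:C *: (U *m invmx M *m U^t*)
  else ((x^t* *m x) 0 0)^-1 *: (y *m x^t*).

Definition DeltaJ_hat (K : realType) (n : nat) (J Q : 'M[K[i]]_n)
    (w : K) (x : 'cV[K[i]]_n) : 'M[K[i]]_n :=
  - 'i%C *: Hhat (Q *m x) ('i%C *: (shifted J Q w *m x)).

Definition DeltaR_hat (K : realType) (n : nat) (R Q : 'M[K[i]]_n)
    (x : 'cV[K[i]]_n) : 'M[K[i]]_n :=
  let u := R *m Q *m x in
  if u == 0 then 0
  else (- 1 / (x^t* *m (Q *m R *m Q) *m x) 0 0) *: (u *m u^t*).

(* Main.v *)
(** If (J + DJ - (R + DR)) Q v = i w v and z = Q v, then pairing with z and
    taking real parts gives z^* (R + DR) z = 0, so (R + DR) z = 0; hence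
    DR z = - R z and DJ z = (i w I - J Q) v.  The second equation yields
    |DJ| >= |(i w I - J Q) v| / |z|, and Cauchy-Schwarz for the semidefinite
    form - DR yields |DR| >= |R z|^2 / (z^* R z), so the objective at (w, v) is
    at most |DJ|^2 + |DR|^2.  Conversely, for every w and x <> 0 the pair
    (DeltaJ_hat, DeltaR_hat) is admissible, satisfies both equations and attains
    both bounds.  The norm of Hhat is read off from S^3 = S for the Hermitian
    matrix S = (|x| / |y|) Hhat, so that S^2 is an orthogonal projection. *)
Require Import Defs.
From mathcomp Require Import all_boot all_order all_algebra.
From mathcomp Require Import classical_sets reals constructive_ereal ereal.
From mathcomp Require Import complex.
From mathcomp Require Import ring.

Import Order.TTheory GRing.Theory Num.Theory.

Local Open Scope ring_scope.
Local Open Scope sesquilinear_scope.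

Set Implicit Arguments.
Unset Strict Implicit.

(** * Inner products, Hermitian forms and the Cauchy-Schwarz inequality *)

Section ConjugateTranspose.
Variable C : numClosedFieldType.

Lemma trmxCM m n p (A : 'M[C]_(m, n)) (B : 'M[C]_(n, p)) :
  (A *m B)^t* = B^t* *m A^t*.
Proof. by rewrite trmx_mul map_mxM. Qed.

Lemma trmxCD m n (A B : 'M[C]_(m, n)) : (A + B)^t* = A^t* + B^t*.
Proof. by rewrite linearD /= map_mxD. Qed.

Lemma trmxCN m n (A : 'M[C]_(m, n)) : (- A)^t* = - A^t*.
Proof. by rewrite linearN /= map_mxN. Qed.

Lemma trmxCZ m n a (A : 'M[C]_(m, n)) : (a *: A)^t* = a^* *: A^t*.
Proof. by rewrite linearZ /= map_mxZ. Qed.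

Lemma trmxC0 m n : (0 : 'M[C]_(m, n))^t* = 0.
Proof. by rewrite trmx0 map_mx0. Qed.

Lemma trmxC_inv n (A : 'M[C]_n) : (invmx A)^t* = invmx (A^t*).
Proof. by rewrite trmx_inv map_invmx. Qed.

Definition sform n (A : 'M[C]_n) (x y : 'cV[C]_n) : C := (x^t* *m A *m y) 0 0.

Definition dot n (x y : 'cV[C]_n) : C := (x^t* *m y) 0 0.

Lemma dotE n (x y : 'cV[C]_n) : dot x y = \sum_i (x i 0)^* * y i 0.
Proof. by rewrite /dot mxE; apply: eq_bigr => i _; rewrite !mxE. Qed.

Lemma dot_mx11 n (x y : 'cV[C]_n) : x^t* *m y = (dot x y)%:M.
Proof. by apply/matrixP => i j; rewrite !ord1 [RHS]mxE mulr1n. Qed.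

Lemma dot_conj n (x y : 'cV[C]_n) : (dot x y)^* = dot y x.
Proof.
rewrite !dotE rmorph_sum; apply: eq_bigr => i _.
by rewrite rmorphM /= conjCK mulrC.
Qed.

Lemma dot_ge0 n (x : 'cV[C]_n) : 0 <= dot x x.
Proof.
by rewrite dotE; apply: sumr_ge0 => i _; rewrite mulrC -normCK exprn_ge0.
Qed.

Lemma dot_eq0 n (x : 'cV[C]_n) : (dot x x == 0) = (x == 0).
Proof.
apply/idP/eqP => [|->]; last by rewrite /dot mulmx0 mxE.
rewrite dotE psumr_eq0 => [/allP x0|i _]; last first.
  by rewrite mulrC -normCK exprn_ge0.
apply/matrixP => i j; rewrite ord1 mxE.
have := x0 i (mem_index_enum _).
by rewrite mulrC -normCK expf_eq0 /= normr_eq0 => /eqP.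
Qed.

Lemma dotZr n a (x y : 'cV[C]_n) : dot x (a *: y) = a * dot x y.
Proof. by rewrite /dot -scalemxAr mxE. Qed.

Lemma dotZl n a (x y : 'cV[C]_n) : dot (a *: x) y = a^* * dot x y.
Proof. by rewrite /dot trmxCZ -scalemxAl mxE. Qed.

Lemma dotDr n (x y z : 'cV[C]_n) : dot x (y + z) = dot x y + dot x z.
Proof. by rewrite /dot mulmxDr mxE. Qed.

Lemma dotDl n (x y z : 'cV[C]_n) : dot (x + y) z = dot x z + dot y z.
Proof. by rewrite /dot trmxCD mulmxDl mxE. Qed.

Lemma dotNr n (x y : 'cV[C]_n) : dot x (- y) = - dot x y.
Proof. by rewrite /dot mulmxN mxE. Qed.

Lemma dotNl n (x y : 'cV[C]_n) : dot (- x) y = - dot x y.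
Proof. by rewrite /dot trmxCN mulNmx mxE. Qed.

Lemma sform_dot n (A : 'M[C]_n) x y : sform A x y = dot x (A *m y).
Proof. by rewrite /sform /dot mulmxA. Qed.

Lemma dot_adj m n (A : 'M[C]_(m, n)) x y : dot x (A *m y) = dot (A^t* *m x) y.
Proof. by rewrite /dot trmxCM trmxCK mulmxA. Qed.

Lemma sform_conj n (A : 'M[C]_n) x y :
  A^t* = A -> (sform A x y)^* = sform A y x.
Proof. by move=> Ah; rewrite !sform_dot dot_conj [RHS]dot_adj Ah. Qed.

Lemma sform1 n (x y : 'cV[C]_n) : sform 1%:M x y = dot x y.
Proof. by rewrite sform_dot mul1mx. Qed.

Lemma sform_lincomb n (A : 'M[C]_n) a b x y :
  sform A (a *: x + b *: y) (a *: x + b *: y) =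
  a * a^* * sform A x x + a^* * b * sform A x y +
  (b^* * a * sform A y x + b * b^* * sform A y y).
Proof.
rewrite !sform_dot mulmxDr -!scalemxAr !(dotDl, dotDr, dotZl, dotZr); ring.
Qed.

(* With a = A(x,x), b = A(y,y), c = A(x,y), the values of the form at
   b x - c^* y and at a y - c x add up to (a + b) (a b - |c|^2); if a = b = 0,
   the value at x - c^* y is - 2 |c|^2. *)
Lemma sform_CauchySchwarz n (A : 'M[C]_n) x y :
    A^t* = A -> (forall z, 0 <= sform A z z) ->
  `|sform A x y| ^+ 2 <= sform A x x * sform A y y.
Proof.
move=> Ah A0; rewrite normCK sform_conj //.
have xy : (sform A x y)^* = sform A y x by rewrite sform_conj.
have yx : (sform A y x)^* = sform A x y by rewrite sform_conj.
have xx : (sform A x x)^* = sform A x x by rewrite sform_conj.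
have yy : (sform A y y)^* = sform A y y by rewrite sform_conj.
move: (sform A x x) (sform A x y) (sform A y x) (sform A y y)
  xy yx xx yy (A0 x) (A0 y) (fun a b => sform_lincomb A a b x y).
move=> a c d b xy yx xx yy a0 b0 E.
rewrite -subr_ge0; have [ab0|ab0] := eqVneq (a + b) 0; last first.
  have ab_gt0 : 0 < a + b by rewrite lt0r ab0 addr_ge0.
  rewrite -(pmulr_rge0 _ ab_gt0).
  suff -> : (a + b) * (a * b - c * d) =
    sform A (b *: x + (- d) *: y) (b *: x + (- d) *: y) +
    sform A ((- c) *: x + a *: y) ((- c) *: x + a *: y) by exact: addr_ge0.
  rewrite !E !rmorphN /= xy yx xx yy; ring.
have [/eqP ea /eqP eb] : a == 0 /\ b == 0.
  by apply/andP; rewrite -paddr_eq0 // ab0.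
have := A0 (1 *: x + (- d) *: y); rewrite E !rmorphN rmorph1 /= yx ea eb.
suff -> : 1 * 1 * 0 + 1 * - d * c + (- c * 1 * d + - d * - c * 0) =
  (0 * 0 - c * d) * 2 by rewrite pmulr_lge0 // ltr0n.
by ring.
Qed.

Lemma dot_CauchySchwarz n (x y : 'cV[C]_n) :
  `|dot x y| ^+ 2 <= dot x x * dot y y.
Proof.
rewrite -!sform1; apply: sform_CauchySchwarz => [|z].
  by rewrite trmx1 map_mx1.
by rewrite sform1 dot_ge0.
Qed.

(** Cauchy-Schwarz for the form at [A *m x] and [x] bounds |A x|^4 by a multiple of x^* A x. *)
Lemma sform_eq0_ker n (A : 'M[C]_n) x :
    A^t* = A -> (forall z, 0 <= sform A z z) ->
  sform A x x = 0 -> A *m x = 0.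
Proof.
move=> Ah A0 x0; apply/eqP; rewrite -dot_eq0 -sform_dot -normr_eq0.
rewrite -sqrf_eq0 eq_le exprn_ge0 // andbT.
by have := sform_CauchySchwarz (A *m x) x Ah A0; rewrite x0 mulr0.
Qed.

(** Cauchy-Schwarz in each row; the factor is the squared Frobenius norm of [A]. This later shows
    that the supremum defining [specnorm] runs over a bounded set. *)
Lemma dot_mulmx_bound m n (A : 'M[C]_(m, n)) (x : 'cV[C]_n) :
  dot (A *m x) (A *m x) <=
  (\sum_i dot ((row i A)^t*) ((row i A)^t*)) * dot x x.
Proof.
rewrite dotE mulr_suml; apply: ler_sum => i _.
suff -> : (A *m x) i 0 = dot ((row i A)^t*) x.
  by rewrite mulrC -normCK dot_CauchySchwarz.
by rewrite /dot trmxCK -row_mul [RHS]mxE.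
Qed.

(** * The Hermitian map exchanging two unit vectors *)

Section UnitPair.
Variables (n : nat) (u v : 'cV[C]_n).
Hypotheses (u1 : dot u u = 1) (v1 : dot v v = 1) (uv : dot u v = dot v u).
Hypothesis indep : forall k : 'cV[C]_(1 + 1), row_mx u v *m k = 0 -> k = 0.

Let U : 'M[C]_(n, 1 + 1) := row_mx u v.
Let M : 'M[C]_(1 + 1) := block_mx (u^t* *m v) 1%:M 1%:M (v^t* *m u).
(** The coordinate swap. Both [P *m M] and [M *m P] are the Gram matrix of [u] and [v], whence S U =
    U P: the matrix [S] below exchanges [u] and [v] and kills their orthogonal complement. *)
Let P : 'M[C]_(1 + 1) := block_mx 0 1%:M 1%:M 0.
Let S : 'M[C]_n := U *m invmx M *m U^t*.

Let UadjE : U^t* = col_mx (u^t*) (v^t*).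
Proof. by rewrite /U tr_row_mx map_col_mx. Qed.

Let PP : P *m P = 1%:M.
Proof.
by rewrite mulmx_block !mulmx0 !mul0mx !mulmx1 !add0r !addr0 -scalar_mx_block.
Qed.

Let PM : P *m M = U^t* *m U.
Proof.
rewrite UadjE mul_col_row mulmx_block !mul0mx !mul1mx !add0r !addr0.
by rewrite !dot_mx11 u1 v1 uv.
Qed.

Let MP : M *m P = U^t* *m U.
Proof.
rewrite UadjE mul_col_row mulmx_block !mulmx0 !mulmx1 !add0r !addr0.
by rewrite !dot_mx11 u1 v1 uv.
Qed.

(** If k M = 0, then |U k^*|^2 = k M P k^* = 0, and independence of the columns of [U] gives k =
    0. *)
Let M_unit : M \in unitmx.
Proof.
rewrite -row_free_unit; apply: inj_row_free => k kM.
have Uk : U *m k^t* = 0.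
  apply/eqP; rewrite -dot_eq0 /dot trmxCM trmxCK -mulmxA (mulmxA _ U).
  by rewrite -MP !mulmxA kM !mul0mx mxE.
by rewrite -[k]trmxCK (indep Uk) trmxC0.
Qed.

Lemma unit_pair_swap_adj : S^t* = S.
Proof.
rewrite /S !trmxCM trmxCK trmxC_inv mulmxA; congr (_ *m invmx _ *m _).
rewrite /M tr_block_mx map_block_mx.
rewrite !trmxCM !trmxCK !trmx1 !map_mx1.
by rewrite !dot_mx11 uv.
Qed.

Lemma unit_pair_swap_r : S *m v = u.
Proof.
have -> : v = U *m col_mx 0 1%:M by rewrite mul_row_col mulmx0 mulmx1 add0r.
rewrite /S -!mulmxA (mulmxA _ U) -MP -!mulmxA mulKmx //.
rewrite mul_block_col !mulmx0 mul0mx mulmx1 !add0r.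
by rewrite mul_row_col mulmx1 mulmx0 addr0.
Qed.

(** Since [S] is Hermitian and S^4 = S^2, the nonnegative number |w - S^2 w|^2 equals |w|^2 - |S
    w|^2. *)
Lemma unit_pair_swap_contract w : dot (S *m w) (S *m w) <= dot w w.
Proof.
(* Each inner Gram matrix is written as P M or M P, whichever cancels a neighbouring inverse; the
   two swaps left over cancel by P P = 1. *)
have SSS : S *m (S *m S) = S.
  rewrite /S -!mulmxA (mulmxA _ U) -PM (mulmxA _ U) -MP -!mulmxA.
  rewrite (mulKVmx M_unit) (mulmxA M P) MP -PM -!mulmxA (mulKVmx M_unit).
  by rewrite (mulmxA P P) PP mul1mx.
have SE x y : dot (S *m x) y = dot x (S *m y).
  by rewrite dot_adj unit_pair_swap_adj.
have := dot_ge0 (w - S *m (S *m w)).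
rewrite !(dotDl, dotDr, dotNl, dotNr) !SE.
have -> : S *m (S *m (S *m (S *m w))) = S *m (S *m w).
  by congr (_ *m _); rewrite -[in RHS]SSS -!mulmxA.
by rewrite opprK addNr addr0 subr_ge0.
Qed.
End UnitPair.
End ConjugateTranspose.

Lemma free_pair (F : fieldType) (vT : vectType F) (x y : vT) :
  x != 0 -> free [:: x; y] = (y \notin <[x]>%VS).
Proof.
move=> x0; rewrite (@perm_free _ _ _ [:: y; x]).
  by rewrite free_cons seq1_free x0 andbT span_seq1.
exact: (permEl (perm_catC [:: x] [:: y])).
Qed.

(** * Euclidean and spectral norms *)

Section SpectralNorm.
Variable K : realType.
Local Notation "x %:C" := (real_complex K x).

Lemma real_complex_conj (a : K) : (a%:C)^* = a%:C.
Proof. exact: conjc_real. Qed.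

Lemma conj_i : ('i%C : K[i])^* = - 'i%C.
Proof. by apply/eqP; rewrite eq_complex /= oppr0 !eqxx. Qed.

Lemma ge0_complexE (z : K[i]) : 0 <= z -> z = (complex.Re z)%:C.
Proof. by move=> z0; rewrite RRe_real // ger0_real. Qed.

Lemma enorm_ge0 n (x : 'cV[K[i]]_n) : 0 <= enorm x.
Proof. exact: sqrtr_ge0. Qed.

Lemma enorm_sqr n (x : 'cV[K[i]]_n) : (enorm x ^+ 2)%:C = dot x x.
Proof.
have := dot_ge0 x; rewrite /enorm -/(dot x x) => x0.
rewrite sqr_sqrtr -?ge0_complexE //.
by move: x0; rewrite lecE => /andP[].
Qed.

Lemma enorm_sqrC n (x : 'cV[K[i]]_n) : (enorm x)%:C ^+ 2 = dot x x.
Proof. by rewrite -enorm_sqr rmorphXn. Qed.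

Lemma enorm_eq0 n (x : 'cV[K[i]]_n) : (enorm x == 0) = (x == 0).
Proof. by rewrite -dot_eq0 -enorm_sqr fmorph_eq0 sqrf_eq0. Qed.

Lemma enorm_gt0 n (x : 'cV[K[i]]_n) : x != 0 -> 0 < enorm x.
Proof. by move=> x0; rewrite lt0r enorm_eq0 x0 enorm_ge0. Qed.

Lemma enormZ n a (x : 'cV[K[i]]_n) : (enorm (a *: x))%:C = `|a| * (enorm x)%:C.
Proof.
have C0 m (y : 'cV[K[i]]_m) : 0 <= (enorm y)%:C by rewrite ler0c enorm_ge0.
apply/eqP; rewrite -(@eqrXn2 _ 2) ?mulr_ge0 // exprMn !enorm_sqrC.
by rewrite dotZr dotZl mulrA -normCK.
Qed.

Lemma enormZr n (a : K) (x : 'cV[K[i]]_n) :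
  0 <= a -> enorm (a%:C *: x) = a * enorm x.
Proof.
move=> a0; apply: (@complexI K); rewrite enormZ ger0_norm ?ler0c //.
by rewrite rmorphM.
Qed.

Lemma enorm_unitZ n a (x : 'cV[K[i]]_n) : `|a| = 1 -> enorm (a *: x) = enorm x.
Proof. by move=> a1; apply: (@complexI K); rewrite enormZ a1 mul1r. Qed.

Lemma enorm_le n m (c : K) (x : 'cV[K[i]]_n) (y : 'cV[K[i]]_m) :
  0 <= c -> dot x x <= (c ^+ 2)%:C * dot y y -> enorm x <= c * enorm y.
Proof.
move=> c0; rewrite -!enorm_sqr -rmorphM lecR -exprMn ler_sqr //.
  by rewrite nnegrE enorm_ge0.
by rewrite nnegrE mulr_ge0 ?enorm_ge0.
Qed.

Lemma enorm_CauchySchwarz n (x y : 'cV[K[i]]_n) :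
  `|dot x y| <= (enorm x * enorm y)%:C.
Proof.
rewrite -(@ler_sqr K[i]) ?nnegrE // ?ler0c ?mulr_ge0 ?enorm_ge0 //.
by rewrite rmorphM exprMn !enorm_sqrC dot_CauchySchwarz.
Qed.

Section Specnorm.
Variables (n : nat) (A : 'M[K[i]]_n).

Lemma enorm_mulmx_bounded :
  exists M : K, forall x : 'cV[K[i]]_n, enorm (A *m x) <= M * enorm x.
Proof.
pose s := \sum_i enorm ((row i A)^t*) ^+ 2.
have s0 : 0 <= s by apply: sumr_ge0 => i _; rewrite exprn_ge0 ?enorm_ge0.
exists (Num.sqrt s) => x; apply: enorm_le; first exact: sqrtr_ge0.
rewrite sqr_sqrtr // /s rmorph_sum /=.
under eq_bigr do rewrite enorm_sqr.
exact: dot_mulmx_bound.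
Qed.

Lemma enorm_mulmx_specnorm x : enorm (A *m x) <= specnorm A * enorm x.
Proof.
have [->|x0] := eqVneq x 0.
  by rewrite mulmx0 (eqP (_ : enorm 0 == 0)) ?enorm_eq0 // mulr0.
have ex := enorm_gt0 x0.
rewrite -ler_pdivrMr // mulrC -enormZr ?invr_ge0 ?enorm_ge0 // scalemxAr.
apply: ub_le_sup; last first.
  exists ((enorm x)^-1%:C *: x) => //=.
  by rewrite enormZr ?invr_ge0 ?enorm_ge0 // mulVf // gt_eqF.
have [M AM] := enorm_mulmx_bounded; exists M => _ [y /= y1 <-].
by have := AM y; rewrite y1 mulr1.
Qed.

(** The tool for every exact norm below: a bound on the unit sphere that is attained in one
    direction is the supremum. *)
Lemma specnorm_eq (a : K) z : z != 0 -> enorm (A *m z) = a * enorm z ->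
  (forall w, enorm (A *m w) <= a * enorm w) -> specnorm A = a.
Proof.
move=> z0 Az Aw; have ez := enorm_gt0 z0.
apply/eqP; rewrite eq_le; apply/andP; split; last first.
  by rewrite -(ler_pM2r ez) -Az enorm_mulmx_specnorm.
apply: ge_sup.
  exists (enorm (A *m ((enorm z)^-1%:C *: z))), ((enorm z)^-1%:C *: z) => //=.
  by rewrite enormZr ?invr_ge0 ?enorm_ge0 // mulVf // gt_eqF.
by move=> _ [y /= y1 <-]; have := Aw y; rewrite y1 mulr1.
Qed.

Lemma specnorm_ge0 (z : 'cV[K[i]]_n) : z != 0 -> 0 <= specnorm A.
Proof.
move=> z0; rewrite -(pmulr_lge0 _ (enorm_gt0 z0)).
exact: le_trans (enorm_ge0 _) (enorm_mulmx_specnorm z).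
Qed.

End Specnorm.
End SpectralNorm.

(** * Column eigenvectors and minimal Hermitian mapping matrices *)

Section Perturbations.
Variables (K : realType) (n : nat).
Local Notation "x %:C" := (real_complex K x).
Implicit Types (x y z u w : 'cV[K[i]]_n).

(** [eigenvalue] speaks of row vectors; A - l I and its transpose are singular together, which gives
    column eigenvectors. *)
Lemma right_eigenvalueP (A : 'M[K[i]]_n) l :
  reflect (exists2 v : 'cV[K[i]]_n, A *m v = l *: v & v != 0) (eigenvalue A l).
Proof.
have -> : eigenvalue A l = eigenvalue A^T l.
  rewrite /eigenvalue /eigenspace !kermx_eq0 !row_free_unit -unitmx_tr.
  by rewrite linearB /= tr_scalar_mx.
apply: (iffP eigenvalueP) => [] [v vA v0]; exists v^T; rewrite ?trmx_eq0 //.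
- by apply: trmx_inj; rewrite trmx_mul linearZ /= trmxK vA.
- by rewrite -trmx_mul vA linearZ.
Qed.

(** Supplies the independence hypothesis on the unit pair: a nonzero coefficient of [y] would put
    [y] on the line of [x]. *)
Lemma free_pair_ker x y a b (k : 'cV[K[i]]_(1 + 1)) :
    x != 0 -> y \notin <[x]>%VS -> a != 0 -> b != 0 ->
  row_mx (a *: y) (b *: x) *m k = 0 -> k = 0.
Proof.
move=> x0 yx a0 b0; rewrite -[k]vsubmxK mul_row_col.
set k1 := usubmx k; set k2 := dsubmx k.
rewrite [k1]mx11_scalar [k2]mx11_scalar !mul_mx_scalar !scalerA.
move: (k1 0 0) (k2 0 0) => {k1 k2} c d E.
have c0 : c = 0.
  apply: contraNeq yx => c0; apply/vlineP; exists (- (d * b) / (c * a)).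
  have ca0 : c * a != 0 by rewrite mulf_neq0.
  apply: (scalerI ca0); rewrite [RHS]scalerA [X in X *: x]mulrC divfK //.
  by rewrite scaleNr; apply/eqP; rewrite -addr_eq0 E.
move: E; rewrite c0 mul0r scale0r add0r => /eqP.
rewrite scaler_eq0 (negPf x0) orbF mulf_eq0 (negPf b0) orbF => /eqP ->.
by rewrite !raddf0 col_mx0.
Qed.

(** In the independent case [Hhat x y] is |y| / |x| times the map exchanging the normalized vectors,
    which is a Hermitian contraction; otherwise it is a real multiple of the orthogonal projection
    onto the line of [x]. *)
Lemma HhatP x y : x != 0 -> dot x y = dot y x ->
  [/\ (Hhat x y)^t* = Hhat x y, Hhat x y *m x = y &
      forall w, enorm (Hhat x y *m w) <= enorm y / enorm x * enorm w].
Proof.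
move=> x0 xy; have ex := enorm_gt0 x0.
have exC : (enorm x)%:C != 0 by rewrite fmorph_eq0 gt_eqF.
rewrite /Hhat free_pair //; case: ifPn => [fxy|/negPn/vlineP[k yk]].
  have y0 : y != 0.
    by apply: contraNneq fxy => ->; rewrite mem0v.
  have ey := enorm_gt0 y0.
  have eyC : (enorm y)%:C != 0 by rewrite fmorph_eq0 gt_eqF.
  set u := _^-1%:C *: y; set v := _^-1%:C *: x.
  have u1 : dot u u = 1.
    rewrite /u dotZr dotZl real_complex_conj -enorm_sqr fmorphV rmorphXn /=.
    by field.
  have v1 : dot v v = 1.
    rewrite /v dotZr dotZl real_complex_conj -enorm_sqr fmorphV rmorphXn /=.
    by field.
  have uv : dot u v = dot v u.
    by rewrite /u /v !(dotZr, dotZl) !real_complex_conj xy mulrCA.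
  have -> : (enorm x * enorm y)^-1%:C *: (y^t* *m x) = u^t* *m v.
    rewrite /u /v trmxCZ -scalemxAr -scalemxAl scalerA real_complex_conj.
    by rewrite -rmorphM invfM.
  have -> : (enorm x * enorm y)^-1%:C *: (x^t* *m y) = v^t* *m u.
    rewrite /u /v trmxCZ -scalemxAr -scalemxAl scalerA real_complex_conj.
    by rewrite -rmorphM invfM mulrC.
  have ind (k : 'cV[K[i]]_(1 + 1)) : row_mx u v *m k = 0 -> k = 0.
    by apply: free_pair_ker => //; rewrite ?fmorph_eq0 ?invr_eq0 ?gt_eqF.
  have Sh := unit_pair_swap_adj uv.
  have Sv := unit_pair_swap_r u1 v1 uv ind.
  have Sc := unit_pair_swap_contract u1 v1 uv ind.
  split.
  - by rewrite trmxCZ Sh real_complex_conj.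
  - have xv : (enorm x)%:C *: v = x.
      by rewrite /v scalerA -rmorphM mulfV ?gt_eqF // scale1r.
    rewrite -[X in _ *m X]xv -scalemxAr -scalemxAl Sv /u !scalerA.
    rewrite -[RHS]scale1r; congr (_ *: _).
    rewrite rmorphM /= !fmorphV; field; exact/andP.
  - move=> w; rewrite -scalemxAl enormZr ?divr_ge0 ?enorm_ge0 //.
    apply: ler_wpM2l; first by rewrite divr_ge0 ?enorm_ge0.
    by rewrite -[leRHS]mul1r; apply: enorm_le => //; rewrite expr1n mul1r.
have xx0 : dot x x != 0 by rewrite dot_eq0.
(* The symmetry of [dot x y] forces the factor in y = k x to be real, so that k x x^* is
   Hermitian. *)
have kr : k^* = k.
  move: xy; rewrite yk dotZr dotZl => /eqP.
  by rewrite (inj_eq (mulIf xx0)) => /eqP.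
have HE : ((x^t* *m x) 0 0)^-1 *: (y *m x^t*) = (k / dot x x) *: (x *m x^t*).
  by rewrite yk -scalemxAl scalerA mulrC.
rewrite HE; split.
- by rewrite trmxCZ trmxCM trmxCK rmorphM fmorphV /= kr dot_conj.
- by rewrite -scalemxAl -mulmxA dot_mx11 mul_mx_scalar scalerA divfK.
move=> w; rewrite -scalemxAl -mulmxA dot_mx11 mul_mx_scalar scalerA.
rewrite -lecR enormZ yk !rmorphM fmorphV /= enormZ mulfK //.
have ex_ge0 : 0 <= (enorm x)%:C by rewrite ler0c enorm_ge0.
rewrite !normrM normfV -enorm_sqrC normrX (ger0_norm ex_ge0).
have -> : `|k| / (enorm x)%:C ^+ 2 * `|dot x w| * (enorm x)%:C =
  `|k| * ((enorm x)%:C^-1 * `|dot x w|) by field.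
have := enorm_CauchySchwarz x w; rewrite rmorphM /= => CS.
by rewrite ler_wpM2l // ler_pdivrMl // lt0r exC.
Qed.


Lemma sform_rank1 a u y : sform (a *: (u *m u^t*)) y y = a * `|dot u y| ^+ 2.
Proof.
rewrite sform_dot -scalemxAl -mulmxA dot_mx11 mul_mx_scalar scalerA dotZr.
by rewrite normCK dot_conj mulrA.
Qed.

Lemma enorm_rank1 a u y :
  (enorm ((a *: (u *m u^t*)) *m y))%:C = `|a| * `|dot u y| * (enorm u)%:C.
Proof.
by rewrite -scalemxAl -mulmxA dot_mx11 mul_mx_scalar scalerA enormZ normrM.
Qed.

Lemma specnorm0 z : z != 0 -> specnorm (0 : 'M[K[i]]_n) = 0.
Proof.
have e0 : enorm (0 : 'cV[K[i]]_n) = 0 by apply/eqP; rewrite enorm_eq0.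
by move=> z0; apply: (specnorm_eq z0) => [|w]; rewrite !mul0mx !mul0r e0.
Qed.

(** * The rank-one perturbation of the damping matrix *)

Section Damping.
Variables (R : 'M[K[i]]_n) (z : 'cV[K[i]]_n).
Hypothesis R_psd : psd R.
Let u := R *m z.
Let r := sform R z z.

Let r_ge0 : 0 <= r. Proof. by case: R_psd => _; apply. Qed.

(** The denominator z^* R z can vanish only together with R z, as [R] is semidefinite. *)
Let r_gt0 : u != 0 -> 0 < r.
Proof.
move=> u0; rewrite lt0r r_ge0 andbT; apply: contraNneq u0 => r0.
by case: R_psd => Rh R0; apply/eqP/sform_eq0_ker.
Qed.

(** This is [DeltaR_hat] in the variable z = Q x, namely - R z z^* R / (z^* R z). *)
Definition damping_hat : 'M[K[i]]_n :=
  if u == 0 then 0 else (- 1 / r) *: (u *m u^t*).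

Lemma damping_hat_nsd : nsd damping_hat.
Proof.
rewrite /damping_hat; case: eqVneq => [_|/r_gt0 r0].
  by split=> [|y]; rewrite ?trmxC0 // mulmx0 mul0mx mxE.
have rr : r^* = r by rewrite geC0_conj.
split=> [|y].
  by rewrite trmxCZ trmxCM trmxCK rmorphM rmorphN rmorph1 fmorphV /= rr.
rewrite -/(sform _ y y) sform_rank1 mulN1r mulNr oppr_le0.
by rewrite mulr_ge0 ?invr_ge0 ?exprn_ge0.
Qed.

(** The form at y is y^* R y - |z^* R y|^2 / (z^* R z), nonnegative by Cauchy-Schwarz for [R]. *)
Lemma damping_hat_psd : psd (R + damping_hat).
Proof.
have [Rh R0] := R_psd; have [Dh _] := damping_hat_nsd.
split=> [|y]; first by rewrite trmxCD Rh Dh.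
rewrite -/(sform _ y y) sform_dot mulmxDl dotDr -!sform_dot /damping_hat.
case: eqVneq => [_|/r_gt0 r0].
  by rewrite {2}/sform mulmx0 mul0mx [X in _ + X]mxE addr0; apply: R0.
rewrite sform_rank1 mulN1r mulNr subr_ge0 ler_pdivrMl //.
have -> : dot u y = sform R z y by rewrite sform_dot dot_adj Rh.
exact: sform_CauchySchwarz.
Qed.

Lemma damping_hat_apply : damping_hat *m z = - u.
Proof.
have [Rh _] := R_psd.
rewrite /damping_hat; case: eqVneq => [->|/r_gt0 r0].
  by rewrite mul0mx oppr0.
rewrite -scalemxAl -mulmxA dot_mx11 mul_mx_scalar scalerA.
have -> : dot u z = r by rewrite /r sform_dot dot_adj Rh.
by rewrite divfK ?gt_eqF // scaleN1r.
Qed.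

(** The rank-one matrix u u^* has norm |u|^2, attained at u. If u = 0, the right side is 0 / 0 = 0,
    as in the Rayleigh convention. *)
Lemma specnorm_damping_hat : z != 0 ->
  specnorm damping_hat = enorm u ^+ 2 / complex.Re r.
Proof.
move=> z0; rewrite /damping_hat; case: eqVneq => [u0|u0].
  rewrite (specnorm0 z0) (_ : enorm u = 0) ?expr0n ?mul0r //.
  by apply/eqP; rewrite enorm_eq0 u0.
have r0 := r_gt0 u0; have rE := ge0_complexE r_ge0.
have q0 : 0 < complex.Re r by move: r0; rewrite ltcE => /andP[].
have nr : `|- 1 / r| = (complex.Re r)^-1%:C.
  by rewrite normrM normrN1 mul1r normfV ger0_norm // {1}rE fmorphV.
apply: (specnorm_eq u0) => [|w].
  apply: (@complexI K); rewrite enorm_rank1 nr ger0_norm ?dot_ge0 //.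
  by rewrite -enorm_sqr -!rmorphM /= mulrC; congr (_ %:C); ring.
rewrite -lecR enorm_rank1 nr.
have -> : (enorm u ^+ 2 / complex.Re r * enorm w)%:C =
  (complex.Re r)^-1%:C * (enorm u * enorm w)%:C * (enorm u)%:C.
  by rewrite -!rmorphM; congr (_ %:C); ring.
rewrite ler_wpM2r ?ler0c ?enorm_ge0 // ler_wpM2l ?enorm_CauchySchwarz //.
by rewrite ler0c invr_ge0 ltW.
Qed.

End Damping.

(* Cauchy-Schwarz for the form - D at u = R z and z, where - D z = u, reads
   |u|^4 <= (u^* (- D) u) (z^* R z), and u^* (- D) u <= |D| |u|^2. *)
Lemma damping_norm_lower (R D : 'M[K[i]]_n) z : z != 0 -> psd R -> nsd D ->
    D *m z = - (R *m z) ->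
  enorm (R *m z) ^+ 2 / complex.Re (sform R z z) <= specnorm D.
Proof.
move=> z0 [Rh R0] [Dh D0] Dz.
have s0 := specnorm_ge0 D z0; set s := specnorm D in s0 *.
set u := R *m z; have [u0|u0] := eqVneq u 0.
  rewrite (_ : enorm u = 0) ?expr0n ?mul0r //.
  by apply/eqP; rewrite enorm_eq0 u0.
have eu := enorm_gt0 u0.
have Nh : (- D)^t* = - D by rewrite trmxCN Dh.
have N0 y : 0 <= sform (- D) y y.
  by rewrite sform_dot mulNmx dotNr -sform_dot oppr_ge0; apply: D0.
have Nz : - D *m z = u by rewrite mulNmx Dz opprK.
have rE : sform (- D) z z = sform R z z by rewrite !sform_dot Nz.
have rC : sform R z z = (complex.Re (sform R z z))%:C.
  exact: ge0_complexE (R0 z).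
set r := complex.Re _ in rC *.
have r0 : 0 <= r by rewrite -ler0c -rC; apply: R0.
have Nu : sform (- D) u u <= (s * enorm u ^+ 2)%:C.
  rewrite -[leLHS]ger0_norm // sform_dot.
  apply: le_trans (enorm_CauchySchwarz _ _) _; rewrite lecR mulNmx.
  rewrite -scaleN1r enorm_unitZ ?normrN1 // expr2 mulrCA.
  rewrite ler_wpM2l ?enorm_ge0 //.
  exact: enorm_mulmx_specnorm.
have := sform_CauchySchwarz u z Nh N0.
rewrite sform_dot Nz ger0_norm ?dot_ge0 // rE rC -enorm_sqr -rmorphXn /= => CS.
have : (enorm u ^+ 2) ^+ 2 <= s * enorm u ^+ 2 * r.
  by rewrite -lecR; apply: le_trans CS _; rewrite rmorphM ler_wpM2r ?ler0c.
have e2 : 0 < enorm u ^+ 2 by rewrite exprn_gt0.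
rewrite [leLHS]expr2 [leRHS]mulrAC ler_pM2r // => le.
(* With z^* R z = 0 the inequality would read |u|^2 <= 0, against u <> 0; so the division is
   legitimate. *)
have [r00|r00] := eqVneq r 0; first by move: le; rewrite r00 mulr0 leNgt e2.
by rewrite ler_pdivrMr // lt0r r00.
Qed.

End Perturbations.

(** * The objective function and the stability radius *)

Section StabilityRadius.
Variables (K : realType) (n : nat) (J R Q : 'M[K[i]]_n).
Hypotheses (J_skew : J^t* = - J) (R_psd : psd R) (Q_posdef : posdef Q).
Local Notation "x %:C" := (real_complex K x).
Implicit Types (w : K) (x : 'cV[K[i]]_n).

Let Qh : Q^t* = Q. Proof. by case: Q_posdef. Qed.
Let Rh : R^t* = R. Proof. by case: R_psd. Qed.

Let Qx0 x : x != 0 -> Q *m x != 0.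
Proof.
case: Q_posdef => _ Q0 x0; apply: contraTneq (Q0 _ x0) => Qx.
by rewrite -mulmxA Qx mulmx0 mxE ltxx.
Qed.

(** Division in a field of the library sends 0 / 0 to 0, in agreement with the convention. *)
Lemma rayleighE (A B : 'M[K[i]]_n) x : rayleigh A B x = qform A x / qform B x.
Proof.
by rewrite /rayleigh; case: ifP => // /andP[/eqP -> _]; rewrite mul0r.
Qed.

Lemma qform_gram m (A : 'M[K[i]]_(m, n)) x :
  complex.Re ((x^t* *m (A^t* *m A) *m x) 0 0) = enorm (A *m x) ^+ 2.
Proof.
apply: (@complexI K); rewrite enorm_sqr -ge0_complexE.
  by rewrite -[LHS]/(sform _ _ _) sform_dot -mulmxA dot_adj trmxCK.
by rewrite -[leRHS]/(sform _ _ _) sform_dot -mulmxA dot_adj trmxCK dot_ge0.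
Qed.

Lemma sform_mulmx x : sform R (Q *m x) (Q *m x) = sform (Q *m R *m Q) x x.
Proof. by rewrite /sform trmxCM Qh !mulmxA. Qed.

(** As [R] and [Q] are Hermitian, Q R^2 Q and Q^2 are Gram matrices; in terms of z = Q x both
    quotients then take the shape of the norm bounds for the two perturbations. *)
Lemma objectiveE w x : objective J R Q w x =
  (enorm (R *m (Q *m x)) ^+ 2 / complex.Re (sform R (Q *m x) (Q *m x))) ^+ 2 +
  (enorm (shifted J Q w *m x) / enorm (Q *m x)) ^+ 2.
Proof.
rewrite /objective !rayleighE [X in _ = _ + X]expr_div_n.
rewrite [qform ((shifted _ _ _)^t* *m _) x]qform_gram.
have -> : qform (Q *m Q) x = enorm (Q *m x) ^+ 2.
  by have := qform_gram Q x; rewrite Qh.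
have -> : qform (Q *m (R *m R) *m Q) x = enorm (R *m (Q *m x)) ^+ 2.
  by have := qform_gram (R *m Q) x; rewrite trmxCM Rh Qh /qform !mulmxA.
congr ((_ / _) ^+ 2 + _); rewrite /qform; congr complex.Re.
exact/esym/sform_mulmx.
Qed.

Lemma objective_ge0 w x : 0 <= objective J R Q w x.
Proof. by rewrite objectiveE addr_ge0 ?sqr_ge0. Qed.

(** With z = Q x and b = (i w I - J Q) x, the factor -i makes the Hermitian [Hhat] skew-Hermitian
    and turns H z = i b into - i H z = b, without changing the norm. *)
Lemma DeltaJ_hatP w x : x != 0 ->
  [/\ (DeltaJ_hat J Q w x)^t* = - DeltaJ_hat J Q w x,
      DeltaJ_hat J Q w x *m (Q *m x) = shifted J Q w *m x &
      specnorm (DeltaJ_hat J Q w x) =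
        enorm (shifted J Q w *m x) / enorm (Q *m x)].
Proof.
move=> x0; have z0 := Qx0 x0; rewrite /DeltaJ_hat.
set z := Q *m x in z0 *; set b := shifted J Q w *m x.
have ii : 'i%C * 'i%C = -1 :> K[i] by rewrite -expr2 sqr_i.
have ni : `|'i%C : K[i]| = 1.
  by apply/eqP; rewrite -sqrp_eq1 // normCK conj_i mulrN ii opprK.
(* z^* b is imaginary, because z^* x = x^* Q x is real and z^* J z is imaginary; hence z^* (i b) is
   real, as [HhatP] requires. *)
have zb : dot b z = - dot z b.
  have bE : b = ('i%C * w%:C) *: x - J *m z.
    by rewrite /b /shifted mulmxBl mul_scalar_mx -mulmxA.
  have xz : dot x z = dot z x by rewrite /z dot_adj Qh.
  have zJz : dot z (J *m z) = - dot (J *m z) z.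
    by rewrite dot_adj J_skew mulNmx dotNl.
  rewrite bE !(dotDl, dotDr, dotNl, dotNr, dotZl, dotZr) rmorphM /= conj_i.
  rewrite real_complex_conj xz zJz; ring.
have [] := @HhatP K n z ('i%C *: b) z0 _.
  by rewrite dotZr dotZl conj_i zb mulrNN.
set H := Hhat _ _ => Hh Hz Hw.
have ns : specnorm (- 'i%C *: H) = enorm b / enorm z.
  apply: (specnorm_eq z0) => [|y].
    rewrite -scalemxAl Hz scalerA mulNr ii opprK scale1r divfK //.
    by rewrite gt_eqF ?enorm_gt0.
  rewrite -scalemxAl enorm_unitZ ?normrN //.
  by have := Hw y; rewrite (enorm_unitZ _ ni).
split=> //; first by rewrite trmxCZ Hh rmorphN /= conj_i scaleNr.
by rewrite -scalemxAl Hz scalerA mulNr ii opprK scale1r.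
Qed.

Lemma DeltaR_hatE x : DeltaR_hat R Q x = damping_hat R (Q *m x).
Proof.
have -> : damping_hat R (Q *m x) = if R *m (Q *m x) == 0 then 0 else
    (- 1 / sform (Q *m R *m Q) x x) *: (R *m (Q *m x) *m (R *m (Q *m x))^t*).
  by rewrite /damping_hat sform_mulmx.
by rewrite /DeltaR_hat /sform !mulmxA.
Qed.

Definition destabilizing (D : 'M[K[i]]_n * 'M[K[i]]_n) : Prop :=
  Sd R D /\ exists l : K[i],
    eigenvalue ((J + D.1 - (R + D.2)) *m Q) l /\ complex.Re l = 0.

(** At z = Q x the perturbed damping vanishes and (J + DJ) z = J z + (i w I - J Q) x = i w x, so [x]
    is an eigenvector for i w. *)
Lemma hat_destabilizing w x : x != 0 ->
  destabilizing (DeltaJ_hat J Q w x, DeltaR_hat R Q x).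
Proof.
move=> x0; have [DJh DJz _] := DeltaJ_hatP w x0.
split; first split=> //=; rewrite ?DeltaR_hatE.
- exact: damping_hat_nsd.
- exact: damping_hat_psd.
exists ('i%C * w%:C); split; last by rewrite mulrC ReiNIm oppr0.
apply/right_eigenvalueP; exists x => //=.
rewrite -mulmxA mulmxBl !mulmxDl DJz damping_hat_apply // subrr subr0.
by rewrite mulmxBl mul_scalar_mx -mulmxA addrC subrK.
Qed.

Lemma pairnorm_hat w x : x != 0 ->
  pairnorm (DeltaJ_hat J Q w x, DeltaR_hat R Q x) =
  Num.sqrt (objective J R Q w x).
Proof.
move=> x0; have [_ _ DJ] := DeltaJ_hatP w x0; rewrite /pairnorm /= DJ.
by rewrite DeltaR_hatE specnorm_damping_hat ?Qx0 // objectiveE addrC.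
Qed.

Lemma objective_le_pairnorm D : destabilizing D ->
  exists w, exists2 x, x != 0 & Num.sqrt (objective J R Q w x) <= pairnorm D.
Proof.
case: D => DJ DR [[/= DJh DRn RDp] [l [/right_eigenvalueP [x xl x0] l0]]].
have z0 := Qx0 x0; exists (complex.Im l), x => //.
have lE : l = 'i%C * (complex.Im l)%:C by rewrite {1}[l]complexE l0 add0r.
set w := complex.Im l in lE *; set z := Q *m x in z0 *.
have {}xl : (J + DJ) *m z - (R + DR) *m z = l *: x.
  by rewrite -mulmxBl mulmxA.
have [RDh RD0] := RDp.
have RDz : (R + DR) *m z = 0.
  apply: sform_eq0_ker => //; set s := sform _ z z.
  have sE : s = dot z ((J + DJ) *m z) - l * dot z x.
    by rewrite -dotZr -xl dotDr dotNr opprB addrC subrK /s sform_dot.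
  have sr : s^* = s by rewrite sform_conj.
  (* s is real as a value of a Hermitian form, and imaginary because z^* (J + DJ) z and l are
     imaginary while z^* x is real. *)
  have : s = - s.
    rewrite -{1}sr sE rmorphB rmorphM /= !dot_conj.
    rewrite {1}lE rmorphM /= conj_i real_complex_conj.
    have -> : dot ((J + DJ) *m z) z = - dot z ((J + DJ) *m z).
      by rewrite [in RHS]dot_adj trmxCD J_skew DJh -opprD mulNmx dotNl opprK.
    have -> : dot x z = dot z x by rewrite /z dot_adj Qh.
    by rewrite [X in _ = - (_ - X * _)]lE; ring.
  by move/eqP; rewrite -addr_eq0 -mulr2n mulrn_eq0 /= => /eqP.
have DRz : DR *m z = - (R *m z).
  by apply/eqP; rewrite -addr_eq0 addrC -mulmxDl RDz.
have DJz : DJ *m z = shifted J Q w *m x.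
  rewrite /shifted mulmxBl -lE mul_scalar_mx -xl RDz subr0 -mulmxA -/z mulmxDl.
  by rewrite addrC addKr.
rewrite ler_sqrt; last by rewrite addr_ge0 ?sqr_ge0.
have rz0 : 0 <= complex.Re (sform R z z).
  have [_ R0] := R_psd; have := R0 z; rewrite -/(sform _ z z) lecE.
  by case/andP.
rewrite objectiveE addrC lerD //=.
  rewrite lerXn2r ?nnegrE ?(specnorm_ge0 _ z0) ?divr_ge0 ?enorm_ge0 //.
  by rewrite ler_pdivrMr ?enorm_gt0 // -DJz enorm_mulmx_specnorm.
rewrite lerXn2r ?nnegrE ?(specnorm_ge0 _ z0) ?divr_ge0 ?exprn_ge0 ?enorm_ge0 //.
exact: damping_norm_lower.
Qed.

Lemma stability_radius_ge0 : (0 <= stability_radius J R Q)%E.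
Proof.
by apply: le_ereal_inf_tmp => _ [D _ <-]; rewrite lee_fin sqrtr_ge0.
Qed.

Lemma objective_inf_le w x : x != 0 ->
  (objective_inf J R Q <= (objective J R Q w x)%:E)%E.
Proof.
move=> x0; apply: ge_ereal_inf; eexists; first by exists w.
by apply: ge_ereal_inf; exists (objective J R Q w x)%:E => //; exists x.
Qed.

Lemma le_objective_inf (a : \bar K) :
    (forall w x, x != 0 -> (a <= (objective J R Q w x)%:E)%E) ->
  (a <= objective_inf J R Q)%E.
Proof.
move=> H; apply: le_ereal_inf_tmp => _ [w _ <-].
by apply: le_ereal_inf_tmp => _ [x /= x0 <-]; apply: H.
Qed.

Lemma stability_radius_le w x : x != 0 ->
  (stability_radius J R Q <= (Num.sqrt (objective J R Q w x))%:E)%E.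
Proof.
move=> x0; apply: ge_ereal_inf; eexists; last exact: lexx.
exists (DeltaJ_hat J Q w x, DeltaR_hat R Q x); last by rewrite pairnorm_hat.
exact: hat_destabilizing.
Qed.

Lemma stability_radius_sqrt : (0 < n)%N ->
  exists2 m, 0 <= m & objective_inf J R Q = m%:E /\
    stability_radius J R Q = (Num.sqrt m)%:E.
Proof.
(* A nonzero vector makes both infima smaller than +oo; both are nonnegative, so the comparison can
   take place in [K]. *)
move=> n_gt0; have x0 : const_mx 1 != 0 :> 'cV[K[i]]_n.
  apply/eqP => /matrixP /(_ (Ordinal n_gt0) 0); rewrite !mxE.
  exact/eqP/oner_neq0.
have inf_ge0 : (0 <= objective_inf J R Q)%E.
  by apply: le_objective_inf => w x _; rewrite lee_fin objective_ge0.
have := objective_inf_le 0 x0; have := stability_radius_le 0 x0.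
have := stability_radius_ge0.
case rE: (stability_radius J R Q) => [r| |] // r0 _.
case mE: (objective_inf J R Q) inf_ge0 => [m| |] // m0 _.
rewrite !lee_fin in r0 m0; exists m => //; split=> //; congr _%:E.
(* Upper bound: the explicit perturbations make r^2 a lower bound of all objective values. *)
apply/eqP; rewrite eq_le; apply/andP; split.
  rewrite -(ger0_norm r0) -sqrtr_sqr ler_wsqrtr // -lee_fin -mE.
  apply: le_objective_inf => w x xn0; rewrite lee_fin.
  have := stability_radius_le w xn0; rewrite rE lee_fin => le.
  by rewrite -[leRHS]sqr_sqrtr ?objective_ge0 // lerXn2r ?nnegrE ?sqrtr_ge0.
(* Lower bound: every destabilizing pair dominates the square root of some objective value, hence
   that of m. *)
rewrite -lee_fin -rE; apply: le_ereal_inf_tmp => _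
  [D /objective_le_pairnorm[w [x xn0 le]] <-].
rewrite lee_fin; apply: le_trans le.
by rewrite ler_wsqrtr // -lee_fin -mE objective_inf_le.
Qed.

End StabilityRadius.

Unset Implicit Arguments.
Set Strict Implicit.

Theorem theorem3p1 (K : realType) (n : nat) (J R Q : 'M[K[i]]_n)
    (n_gt0 : (0 < n)%N)
    (J_skew : J^t* = - J) (R_psd : psd R) (Q_posdef : posdef Q)
    (stable : asymptotically_stable J R Q) :
  (stability_radius J R Q ^+ 2)%E = objective_inf J R Q
  /\ forall (w : K) (x : 'cV[K[i]]_n), x != 0 ->
       (objective J R Q w x)%:E = objective_inf J R Q ->
       stability_radius J R Q =
         (Num.sqrt (specnorm (DeltaJ_hat J Q w x) ^+ 2
                    + specnorm (DeltaR_hat R Q x) ^+ 2))%:E.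
Proof.
have [m m0 [infE radE]] := stability_radius_sqrt J_skew R_psd Q_posdef n_gt0.
split; first by rewrite infE radE /= -EFinM -expr2 sqr_sqrtr.
move=> w x x0; rewrite radE infE => -[<-].
by rewrite -(pairnorm_hat J_skew R_psd Q_posdef w x0).
Qed.
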